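(* Let $M$ and $N$ be modules over a commutative ring $R$ with identity. Let $T_M$ be the set of all functions $M^n\to M$, $(a_1,\dots,a_n)\mapsto\sum_{i=1}^n r_ia_i$, with $n\in\mathbb{Z}^+$ and $r_1,\dots,r_n\in R$, and let $T_N$ be defined in the same way from $N$. Let $$\theta=\Big\{(\tau_M(f),\tau_N(f)): f=\sum_{i=1}^n r_ix_i,\ r_i\in R,\ n\in\mathbb{Z}^+\Big\},$$ where $\tau_M(f):M^n\to M$ and $\tau_N(f):N^n\to N$ are the functions induced by $f$. If $X$ and $Y$ are nonempty subsets of $M$ and $N$, respectively, then a map $\phi:\langle X\rangle_{T_M}\to\langle Y\rangle_{T_N}$ is an $R$-homomorphism of $R$-modules if and only if $\phi$ is a $\theta$-morphism.
   Context: An operator gen-semigroup on a set $D$ is a set $T$ of functions $D^n\to D$ ($n\in\mathbb{Z}^+$ arbitrary) such that for every $n$-variable $f\in T$ and all $g_1,\dots,g_n\in T$ ($g_i$ of $n_i$ variables), the composite $f\circ(g_1,\dots,g_n):D^{n_1+\cdots+n_n}\to D$, obtained by substituting $g_1,\dots,g_n$, evaluated on consecutive disjoint blocks of variables, into $f$, lies in $T$. Both $T_M$ and $T_N$ are operator gen-semigroups. For $U\subseteq D$, $\langle U\rangle_T=\{f(u_1,\dots,u_n): n\in\mathbb{Z}^+, f\in T\text{ of }n\text{ variables}, u_i\in U\}$; such sets are called $T$-spaces (in the claim, $\langle X\rangle_{T_M}$ and $\langle Y\rangle_{T_N}$ are the submodules generated by $X$ and $Y$). For operator gen-semigroups $T_1,T_2$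 and a relation $\theta\subseteq T_1\times T_2$, and $f\in\operatorname{Dom}\theta$, the expression $\theta(f)(b_1,\dots,b_n)$ is well-defined if every $g$ with $(f,g)\in\theta$ has $n$ variables and all such $g$ take the same value at $(b_1,\dots,b_n)$; $\theta(f)(b_1,\dots,b_n)$ is then that value. A map $\phi$ from a $T_1$-space $S$ to a $T_2$-space is a $\theta$-morphism if for all $n\in\mathbb{Z}^+$, $(a_1,\dots,a_n)\in S^n$ and $f\in\operatorname{Dom}\theta$ of $n$ variables, $\theta(f)(\phi(a_1),\dots,\phi(a_n))$ is well-defined and $\phi(f(a_1,\dots,a_n))=\theta(f)(\phi(a_1),\dots,\phi(a_n))$. Linear forms are regarded together with their number $n$ of variables. *)

(* Defs.v *)
From HB Require Import structures.
From mathcomp Require Import all_boot all_order all_algebra.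
From mathcomp Require Import boolp classical_sets.

Set Implicit Arguments.
Unset Strict Implicit.
Unset Printing Implicit Defensive.

Import GRing.Theory.
Local Open Scope classical_set_scope.
Local Open Scope ring_scope.

(* The number of variables is part of an operator, so that operators with
   different numbers of variables are different even when [D] is a point. *)
Definition operator (D : Type) := {n : nat & ('I_n -> D) -> D}.

Definition Op (D : Type) (n : nat) (f : ('I_n -> D) -> D) : operator D :=
  existT (fun n => ('I_n -> D) -> D) n f.

Definition arity (D : Type) (F : operator D) : nat := projT1 F.

(* [tagnat.Rank i j] is the position [m 0 + ... + m (i - 1) + j], i.e., the
   [j]-th position of the [i]-th of the consecutive blocks of lengths [m i]. *)
Definition gen_comp (D : Type) (n : nat) (f : ('I_n -> D) -> D)
    (m : 'I_n -> nat) (g : forall i, ('I_(m i) -> D) -> D) : operator D :=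
  Op (fun x : 'I_(\sum_i m i)%N -> D =>
        f (fun i => g i (fun j => x (tagnat.Rank i j)))).

Record genSemigroup (D : Type) := GenSemigroup {
  ops : set (operator D);
  ops_arity_gt0 : forall F, ops F -> (0 < arity F)%N;
  ops_comp : forall n (f : ('I_n -> D) -> D) (m : 'I_n -> nat)
      (g : forall i, ('I_(m i) -> D) -> D),
    ops (Op f) -> (forall i, ops (Op (g i))) -> ops (gen_comp f g)
}.

Definition gen_space (D : Type) (T : genSemigroup D) (U : set D) : set D :=
  [set x | exists n (f : ('I_n -> D) -> D) (u : 'I_n -> D),
     [/\ ops T (Op f), (forall i, U (u i)) & x = f u]].

Lemma gen_space_closed (D : Type) (T : genSemigroup D) (U : set D) n
    (f : ('I_n -> D) -> D) (a : 'I_n -> D) :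
  ops T (Op f) -> (forall i, gen_space T U (a i)) -> gen_space T U (f a).
Proof.
move=> Tf Ua.
have {Ua} /choice[m Hm] i : exists k, exists (g : ('I_k -> D) -> D)
    (u : 'I_k -> D), [/\ ops T (Op g), (forall j, U (u j)) & a i = g u] by exact: Ua.
have /all_tag[g Hg] i : {g : ('I_(m i) -> D) -> D & exists u : 'I_(m i) -> D,
    [/\ ops T (Op g), (forall j, U (u j)) & a i = g u]}.
  exact/cid/Hm.
have /all_tag[u Hu] i : {u : 'I_(m i) -> D &
    [/\ ops T (Op (g i)), (forall j, U (u j)) & a i = g i u]}.
  exact/cid/Hg.
exists (\sum_i m i)%N, (projT2 (gen_comp f g)),
  (fun k => u (tag (tagnat.sig k)) (tagged (tagnat.sig k))); split.
- by apply: (@ops_comp _ T _ f m g) => // i; case: (Hu i).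
- by move=> k; case: (Hu (tag (tagnat.sig k))).
- rewrite /=; congr f; apply/funext => i; case: (Hu i) => _ _ ->.
  by congr (g i); apply/funext => j; rewrite /tagnat.Rank tagnat.rankK.
Qed.

Definition gen_act (D : Type) (T : genSemigroup D) (U : set D) n
    (f : ('I_n -> D) -> D) (Tf : ops T (Op f)) (a : 'I_n -> gen_space T U) :
    gen_space T U :=
  exist _ (f (fun i => \val (a i)))
    (mem_set (gen_space_closed Tf (fun i => set_mem (valP (a i))))).

Section ThetaMorphism.
Variables (D1 D2 : Type) (T1 : genSemigroup D1) (T2 : genSemigroup D2).
Variable theta : set (operator D1 * operator D2).

Definition rel_dom : set (operator D1) := [set F | exists G, theta (F, G)].

Definition rel_well_defined n (f : ('I_n -> D1) -> D1) (b : 'I_n -> D2) : Prop :=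
  (forall G, theta (Op f, G) -> arity G = n) /\
  (forall g h : ('I_n -> D2) -> D2,
     theta (Op f, Op g) -> theta (Op f, Op h) -> g b = h b).

(* [v] is the value of [theta f] at [b]; unique under [rel_well_defined]. *)
Definition rel_value n (f : ('I_n -> D1) -> D1) (b : 'I_n -> D2) (v : D2) : Prop :=
  exists2 g : ('I_n -> D2) -> D2, theta (Op f, Op g) & v = g b.

Hypothesis theta_sub : theta `<=` ops T1 `*` ops T2.

Lemma rel_dom_sub F : rel_dom F -> ops T1 F.
Proof. by case=> G /theta_sub[]. Qed.

(* [df] forces [0 < n], since [T1] only has operators with variables. *)
Definition theta_morphism (U1 : set D1) (U2 : set D2)
    (phi : gen_space T1 U1 -> gen_space T2 U2) : Prop :=
  forall n (a : 'I_n -> gen_space T1 U1) (f : ('I_n -> D1) -> D1)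
    (df : rel_dom (Op f)),
    let b i := \val (phi (a i)) in
    rel_well_defined f b /\
    rel_value f b (\val (phi (gen_act (rel_dom_sub df) a))).

End ThetaMorphism.

Section LinearForms.
Variables (R : comPzRingType) (M : lmodType R).

Definition tau n (r : 'I_n -> R) : operator M :=
  Op (fun a : 'I_n -> M => \sum_i r i *: a i).

Definition linear_ops : set (operator M) :=
  [set F | exists n (r : 'I_n -> R), (0 < n)%N /\ F = tau r].

Lemma linear_ops_arity_gt0 F : linear_ops F -> (0 < arity F)%N.
Proof. by case=> n [r [n_gt0 ->]]. Qed.

Lemma linear_opsP n (f : ('I_n -> M) -> M) : linear_ops (Op f) ->
  exists r : 'I_n -> R, f = fun a => \sum_i r i *: a i.
Proof.
case=> k [r [_ E]]; have kn : n = k := congr1 (@arity M) E.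
by subst k; exists r; apply: eq_from_Tagged E.
Qed.

Lemma linear_ops_comp n (f : ('I_n -> M) -> M) (m : 'I_n -> nat)
    (g : forall i, ('I_(m i) -> M) -> M) :
  linear_ops (Op f) -> (forall i, linear_ops (Op (g i))) ->
  linear_ops (gen_comp f g).
Proof.
move=> Lf Lg; have n_gt0 := linear_ops_arity_gt0 Lf.
have m_gt0 i := linear_ops_arity_gt0 (Lg i).
have [r fE] := linear_opsP Lf.
have /all_tag[s gE] i : {s : 'I_(m i) -> R & g i = fun a => \sum_j s j *: a j}.
  exact/cid/linear_opsP.
exists (\sum_i m i)%N, (fun k => r (tagnat.sig1 k) * s _ (tagnat.sig2 k)); split.
  rewrite /= in n_gt0; rewrite (bigD1 (Ordinal n_gt0)) //=.
  exact: leq_trans (m_gt0 _) (leq_addr _ _).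
congr Op; apply/funext => x; rewrite fE.
transitivity (\sum_i \sum_j r i *: (s i j *: x (tagnat.Rank i j))).
  by apply: eq_bigr => i _; rewrite gE scaler_sumr.
have -> : \sum_i \sum_j r i *: (s i j *: x (tagnat.Rank i j)) =
    \sum_(p : {i : 'I_n & 'I_(m i)})
      r (tag p) *: (s _ (tagged p) *: x (tagnat.Rank _ (tagged p))).
  by rewrite (sig_big_dep xpredT (fun=> xpredT)
    (fun i j => r i *: (s i j *: x (tagnat.Rank i j)))).
rewrite (reindex _ (@tagnat.sig_bij_on n m)) /=.
apply: eq_bigr => k _; rewrite scalerA.
by congr (_ *: x _); rewrite tagnat.sig2K.
Qed.

Definition linear_semigroup : genSemigroup M :=
  GenSemigroup linear_ops_arity_gt0 linear_ops_comp.

Definition linear_space (X : set M) : set M := gen_space linear_semigroup X.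

Lemma linear_space_lin (X : set M) (a : R) (x y : M) :
  linear_space X x -> linear_space X y -> linear_space X (a *: x + y).
Proof.
move=> Xx Xy.
pose r (i : 'I_2) := if i == ord0 then a else 1.
pose u (i : 'I_2) := if i == ord0 then x else y.
have -> : a *: x + y = \sum_i r i *: u i.
  by rewrite big_ord_recl big_ord1 /= scale1r.
apply: (@gen_space_closed _ _ _ _ (fun u : 'I_2 -> M => \sum_i r i *: u i)).
  by exists 2%N, r.
by move=> i; rewrite /u; case: ifP.
Qed.

Section Submodule.
Variables (X : set M) (X_neq0 : X !=set0).

Lemma linear_space0 : linear_space X 0.
Proof.
have [x Xx] := X_neq0.
exists 1%N, (fun u : 'I_1 -> M => \sum_i (0 : R) *: u i), (fun=> x); split=> //.
  by exists 1%N, (fun=> 0).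
by rewrite big_ord1 scale0r.
Qed.

Lemma linear_space_closed :
  GRing.subsemimod_closed (fun x => x \in linear_space X).
Proof.
apply: GRing.submod_closed_semi; split; first exact: mem_set linear_space0.
by move=> a x y /set_mem Xx /set_mem Xy; apply/mem_set/linear_space_lin.
Qed.

(* The module structure depends on [X_neq0]: operators have at least one
   variable, so that [linear_space set0 = set0]. *)
Definition submodule of X !=set0 : Type := linear_space X.

HB.instance Definition _ := SubChoice.on (submodule X_neq0).
HB.instance Definition _ :=
  GRing.SubChoice_isSubLmodule.Build R M _ (submodule X_neq0) linear_space_closed.

End Submodule.

End LinearForms.

Section LinearTheta.
Variables (R : comPzRingType) (M N : lmodType R).

Definition linear_theta : set (operator M * operator N) :=
  [set FG | exists n (r : 'I_n -> R), (0 < n)%N /\ FG = (tau M r, tau N r)].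

Lemma linear_theta_sub :
  linear_theta `<=` ops (linear_semigroup M) `*` ops (linear_semigroup N).
Proof. by move=> _ [n [r [n_gt0 ->]]]; split; exists n, r. Qed.

End LinearTheta.

Arguments linear_theta {R} M N _.
Arguments linear_theta_sub {R} M N _ _.

(* Main.v *)
Require Import Defs.
From HB Require Import structures.
From mathcomp Require Import all_boot all_order all_algebra.
From mathcomp Require Import boolp classical_sets.

Set Implicit Arguments.
Unset Strict Implicit.
Unset Printing Implicit Defensive.

Import GRing.Theory.
Local Open Scope classical_set_scope.
Local Open Scope ring_scope.

(** A homomorphism commutes with every linear combination, and commuting with
    the combinations [a x + y] already makes a map a homomorphism; so the claim
    only has to translate between linear forms and the operators they induce.

    The delicate point is that [theta] need not be a function: two forms [r] and
    [s] may induce the same operator on [M] and different operators on [N], when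
    some scalar kills [M] but not [N].  For a homomorphism [phi] this is harmless
    on the image of [phi], as [sum_i r i * phi (a i)] and
    [sum_i s i * phi (a i)] are both [phi] of the same element of [M]
    ([submodule_linear_sum]).  Conversely, the value that a [theta]-morphism
    provides for the operator induced by [r] may come from another form [s], and
    well-definedness is what replaces [s] by [r]
    ([theta_morphism_linear_sum]). *)

(** Equality of operators is equality of dependent pairs; matching the two
    numbers of variables once here yields plain equalities of functions. *)
Lemma linear_theta_OpP (R : comPzRingType) (M N : lmodType R) (n : nat)
    (f : ('I_n -> M) -> M) (G : operator N) :
  linear_theta M N (Op f, G) ->
  exists r : 'I_n -> R,
    f = (fun a => \sum_i r i *: a i) /\ G = tau N r.
Proof.
case=> k [r [_ FG]].
have E : Op f = tau M r := congr1 fst FG.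
have -> : G = tau N r := congr1 snd FG.
have nk : n = k := congr1 (@arity M) E.
by subst k; exists r; split=> //; apply: eq_from_Tagged E.
Qed.

Section LinearMaps.
Variables (R : comPzRingType) (M N : lmodType R) (X : set M) (Y : set N).
Variables (X_neq0 : X !=set0) (Y_neq0 : Y !=set0).

(** The combination is taken in the ambient module, so the right-hand side
    depends on the coefficients [r] only through [\val z]: this is what makes
    the choice of a form inducing a given operator irrelevant. *)
Lemma submodule_linear_sum (phi : submodule X_neq0 -> submodule Y_neq0) :
  linear phi -> forall n (r : 'I_n -> R) (a : 'I_n -> submodule X_neq0)
    (z : submodule X_neq0),
  \val z = \sum_i r i *: \val (a i) ->
  \val (phi z) = \sum_i r i *: \val (phi (a i)).
Proof.
move=> phi_lin n r a z zE.
pose phiL := GRing.isLinear.Build R _ _ _ phi phi_lin.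
pose phi' : {linear submodule X_neq0 -> submodule Y_neq0} := HB.pack phi phiL.
have {zE} -> : z = \sum_i r i *: a i.
  apply: val_inj; rewrite zE linear_sum.
  by apply: eq_bigr => i _; rewrite linearZ.
rewrite -[phi]/(phi' : _ -> _) !linear_sum.
by apply: eq_bigr => i _; rewrite !linearZ.
Qed.

(** [rel_value] yields some operator related to the one induced by [r], but
    perhaps not [tau N r]; the uniqueness half of [rel_well_defined] identifies
    their values at the images of the [a i]. *)
Lemma theta_morphism_linear_sum
    (phi : gen_space (linear_semigroup M) X ->
           gen_space (linear_semigroup N) Y) :
  theta_morphism (linear_theta_sub M N) phi ->
  forall n (r : 'I_n -> R) (a : 'I_n -> gen_space (linear_semigroup M) X)
    (z : gen_space (linear_semigroup M) X),
  (0 < n)%N -> \val z = \sum_i r i *: \val (a i) ->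
  \val (phi z) = \sum_i r i *: \val (phi (a i)).
Proof.
move=> phi_theta n r a z n_gt0 zE.
have r_theta : linear_theta M N (tau M r, tau N r) by exists n, r.
have r_dom : rel_dom (linear_theta M N) (tau M r) by exists (tau N r).
have [[_ r_uniq] [g g_theta phiE]] := phi_theta n a _ r_dom.
have -> : z = gen_act (rel_dom_sub (linear_theta_sub M N) r_dom) a.
  exact: val_inj.
by rewrite phiE (r_uniq _ _ g_theta r_theta).
Qed.

End LinearMaps.

Theorem proposition8p5p9 (R : comPzRingType) (M N : lmodType R)
    (X : set M) (Y : set N) (X_neq0 : X !=set0) (Y_neq0 : Y !=set0)
    (phi : gen_space (linear_semigroup M) X -> gen_space (linear_semigroup N) Y) :
  linear (phi : submodule X_neq0 -> submodule Y_neq0) <->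
  theta_morphism (linear_theta_sub M N) phi.
Proof.
split=> [phi_lin n a f df b | phi_theta c x y].
- have valE (g : ('I_n -> N) -> N) : linear_theta M N (Op f, Op g) ->
      \val (phi (gen_act (rel_dom_sub (linear_theta_sub M N) df) a)) = g b.
    move=> /linear_theta_OpP[r [fE gE]].
    rewrite (eq_from_Tagged gE).
    apply: (submodule_linear_sum phi_lin).
    by rewrite /= {1}fE.
  split; first split.
  + by move=> G /linear_theta_OpP[r [_ ->]].
  + by move=> g h /valE <- /valE <-.
  + have [r r_theta] : exists r : 'I_n -> R, linear_theta M N (Op f, tau N r).
      case: df {valE} => G G_theta; have [r [_ GE]] := linear_theta_OpP G_theta.
      by exists r; rewrite -GE.
    by exists (fun u => \sum_i r i *: u i) => //; exact: valE r_theta.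
- pose r (i : 'I_2) := if i == ord0 then c else 1.
  pose u (i : 'I_2) := if i == ord0 then x else y.
  have zE : \val (c *: x + y) = \sum_i r i *: \val (u i).
    by rewrite linearP big_ord_recl big_ord1 /= scale1r.
  apply: val_inj; rewrite linearP.
  have phiE := theta_morphism_linear_sum phi_theta (ltn0Sn 1) zE.
  apply: (etrans phiE).
  by rewrite big_ord_recl big_ord1 /= scale1r.
Qed.
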